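(* The following equalities hold. (i) For every integer $n\ge 3$, $C_t^{oi}(K_n)=3$. (ii) For all positive integers $r\le s$, $C_t^{oi}(K_{r,s})=s+1$. (iii) For every integer $n\ge 3$, $C_t^{oi}(P_n)=3$ if $n=3$, $C_t^{oi}(P_n)=2$ if $n=4$, and $C_t^{oi}(P_n)=3$ if $n\ge 5$. (iv) For every integer $n\ge 3$, $C_t^{oi}(C_n)=3$.
   Context: All graphs are finite, simple and undirected, with vertex set $V(G)$. $K_n$, $P_n$, $C_n$ denote the complete graph, path and cycle on $n$ vertices, and $K_{r,s}$ the complete bipartite graph with partite sets of sizes $r$ and $s$. A set $D\subseteq V(G)$ is a total outer-independent dominating set (TOIDS) of $G$ if every vertex of $G$ is adjacent to at least one vertex of $D$ and $V(G)\setminus D$ is an independent set of $G$. Two nonempty disjoint sets $X,Y\subseteq V(G)$ form a TOI-coalition (are TOI-coalition partners) if neither $X$ nor $Y$ is a TOIDS of $G$ but $X\cup Y$ is a TOIDS of $G$. A TOI-coalition partition of $G$ is a partition $\Psi=\{V_1,\dots,V_k\}$ of $V(G)$ into nonempty sets such that for every $V_i\in\Psi$ there exists $V_j\in\Psi$, $j\ne i$, such that $V_i$ and $V_j$ form a TOI-coalition. The TOI-coalition number $C_t^{oi}(G)$ is the maximum cardinality of a TOI-coalition partition of $G$. *)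

(* Defs.v *)
From HB Require Import structures.
From mathcomp Require Import all_boot.
Set Implicit Arguments.
Unset Strict Implicit.
Unset Printing Implicit Defensive.

Record sgraph := SGraph {
  vertex :> finType;
  adj : rel vertex;
  adj_sym : symmetric adj;
  adj_irr : irreflexive adj }.

Section TOICoalition.
Variable G : sgraph.
Implicit Types (D X Y : {set G}) (Psi : {set {set G}}).

Definition independent D : bool :=
  [forall x in D, forall y in D, ~~ adj x y].

(* Total domination: vertices of D also need a neighbour in D. *)
Definition total_dominating D : bool :=
  [forall x : G, exists y in D, adj x y].

Definition toids D : bool := total_dominating D && independent (~: D).

Definition toi_coalition X Y : bool :=
  [&& X != set0, Y != set0, [disjoint X & Y],
      ~~ toids X, ~~ toids Y & toids (X :|: Y)].

Definition toi_coalition_partition Psi : bool :=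
  partition Psi [set: G] &&
  [forall X in Psi, exists Y in Psi, (Y != X) && toi_coalition X Y].

(* The value is 0 when G has no TOI-coalition partition. *)
Definition toi_coalition_number : nat :=
  \max_(Psi : {set {set G}} | toi_coalition_partition Psi) #|Psi|.

End TOICoalition.

Definition complete_adj n : rel 'I_n := fun i j => i != j.

Lemma complete_adj_sym n : symmetric (@complete_adj n).
Proof. by move=> i j; rewrite /complete_adj eq_sym. Qed.

Lemma complete_adj_irr n : irreflexive (@complete_adj n).
Proof. by move=> i; rewrite /complete_adj eqxx. Qed.

Definition complete_graph n : sgraph :=
  SGraph (@complete_adj_sym n) (@complete_adj_irr n).

Definition biclique_adj r s : rel ('I_r + 'I_s) := fun u v =>
  match u, v with
  | inl _, inr _ | inr _, inl _ => true
  | _, _ => false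
  end.

Lemma biclique_adj_sym r s : symmetric (@biclique_adj r s).
Proof. by case=> [i|i] [j|j]. Qed.

Lemma biclique_adj_irr r s : irreflexive (@biclique_adj r s).
Proof. by case. Qed.

Definition complete_bipartite_graph r s : sgraph :=
  SGraph (@biclique_adj_sym r s) (@biclique_adj_irr r s).

Definition path_adj n : rel 'I_n := fun i j =>
  (i.+1 == j :> nat) || (j.+1 == i :> nat).

Lemma path_adj_sym n : symmetric (@path_adj n).
Proof. by move=> i j; rewrite /path_adj orbC. Qed.

Lemma path_adj_irr n : irreflexive (@path_adj n).
Proof. by move=> i; rewrite /path_adj orbb gtn_eqF. Qed.

Definition path_graph n : sgraph :=
  SGraph (@path_adj_sym n) (@path_adj_irr n).

(* ordS is the successor modulo n; the conjunct i != j only matters for n = 1,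
   where it removes the loop, so that the graph is simple for every n. *)
Definition cycle_adj n : rel 'I_n := fun i j =>
  (i != j) && ((ordS i == j) || (ordS j == i)).

Lemma cycle_adj_sym n : symmetric (@cycle_adj n).
Proof. by move=> i j; rewrite /cycle_adj eq_sym orbC. Qed.

Lemma cycle_adj_irr n : irreflexive (@cycle_adj n).
Proof. by move=> i; rewrite /cycle_adj eqxx. Qed.

Definition cycle_graph n : sgraph :=
  SGraph (@cycle_adj_sym n) (@cycle_adj_irr n).

(* Main.v *)
Require Import Defs.
From mathcomp Require Import all_boot.

Set Implicit Arguments.
Unset Strict Implicit.
Unset Printing Implicit Defensive.

(** The upper bounds rest on two observations valid in every graph. First, two
    TOIDS always meet: a set [D2] disjoint from a TOIDS [D1] lies in the
    independent complement of [D1], so no vertex of [D2] has a neighbour in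
    [D2] ([toids_meet]). Hence, in the graph whose vertices are the parts of a
    TOI-coalition partition and whose edges are the coalitions, any two edges
    share an end and there is no isolated vertex; with more than three parts
    such a graph is a star ([coalition_star]). Second, the centre [X] of the
    star is not a TOIDS: either some vertex has all its neighbours outside
    [X], or some edge has both ends outside [X]. Every leaf of the star has to
    repair this defect, so it contains one of those neighbours, or one end of
    that edge; the leaves being disjoint, there are at most [maxn d 2] of them
    when the degrees are at most [d] ([toi_coalition_number_degree]).

    This gives the bound 3 for paths and cycles, and [s + 1] for bicliques with
    [2 <= s]; the remaining biclique, a single edge, has only two vertices. In
    a complete graph the complement of a TOIDS has at most one element, which
    leaves room for a single part beside two partners. In the path on four
    vertices the TOIDS are exactly the sets containing both inner
    vertices, so every part contains an inner vertex.

    The lower bounds come from star-shaped partitions consisting of one set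
    [D] and all singletons outside it ([star_lower_bound]): one side of the
    biclique, or all vertices but two that are adjacent (complete graphs and
    cycles) or are the two neighbours of a vertex (paths). The path on four
    vertices is cut in the middle. *)

(** * TOIDS and coalitions in an arbitrary graph *)

Section General.
Variable G : sgraph.
Implicit Types (D X Y Z T : {set G}) (Psi : {set {set G}}) (a b v w : G).

Lemma total_dominatingP D :
  reflect (forall v, exists2 w, w \in D & adj v w) (total_dominating D).
Proof.
apply: (iffP forallP) => H v; first by case/existsP: (H v) => w /andP[]; exists w.
by have [w wD vw] := H v; apply/existsP; exists w; rewrite wD.
Qed.

Lemma independentP D :
  reflect {in D &, forall v w, ~~ adj v w} (independent D).
Proof.
apply: (iffP forall_inP) => [H v w vD wD|H v vD].
  by move/forall_inP: (H v vD) => /(_ w wD).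
by apply/forall_inP => w wD; apply: H.
Qed.

Lemma total_dominating1F a : total_dominating [set a] = false.
Proof.
apply/negP => /total_dominatingP/(_ a)[w /set1P->].
by rewrite adj_irr.
Qed.

Lemma toids1F a : toids [set a] = false.
Proof. by rewrite /toids total_dominating1F. Qed.

Lemma independent1 a : independent [set a].
Proof. by apply/independentP => v w /set1P-> /set1P->; rewrite adj_irr. Qed.

Lemma toids_setC1 a :
  (forall v, exists2 w, w != a & adj v w) -> toids (~: [set a]).
Proof.
move=> H; rewrite /toids setCK independent1 andbT.
by apply/total_dominatingP => v; have [w] := H v; exists w; rewrite // !inE.
Qed.

Lemma toids_meet D1 D2 v0 : toids D1 -> toids D2 -> ~~ [disjoint D1 & D2].
Proof.
move=> /andP[_ /independentP ind1] /andP[/total_dominatingP dom2 _].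
apply/negP => dis; have [v vD _] := dom2 v0; have [w wD vw] := dom2 v.
have out x : x \in D2 -> x \in ~: D1.
  by move=> xD; rewrite inE (disjointFl dis xD).
by move: (ind1 v w (out v vD) (out w wD)); rewrite vw.
Qed.

Lemma toi_coalitionC X Y : toi_coalition X Y = toi_coalition Y X.
Proof.
rewrite /toi_coalition disjoint_sym setUC.
by case: (X != set0) (Y != set0) (toids X) (toids Y) => [] [] [] [].
Qed.

Lemma toi_coalition_neq X Y : toi_coalition X Y -> X != Y.
Proof.
case/and5P=> X0 _ dis _ _; apply: contraNneq X0 => eXY.
by rewrite -setI_eq0 -eXY setIid in dis.
Qed.

Lemma coalition_partner Psi X :
  toi_coalition_partition Psi -> X \in Psi ->
  exists2 Y, Y \in Psi & toi_coalition X Y.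
Proof.
case/andP=> _ /forall_inP H XP; have /existsP[Y] := H X XP.
by case/andP=> YP /andP[_ c]; exists Y.
Qed.

(** * Upper bounds *)

Lemma card_trivIset_meet Psi T :
  trivIset Psi -> {in Psi, forall X, ~~ [disjoint X & T]} -> #|Psi| <= #|T|.
Proof.
move=> tr meet; apply: leq_trans (leq_imset_card (pblock Psi) T).
apply/subset_leq_card/subsetP => X XP.
have /pred0Pn[x /andP[/= xX xT]] := meet X XP.
by apply/imsetP; exists x => //; rewrite (def_pblock tr XP xX).
Qed.

(** Used for the graphs whose TOIDS are exactly the supersets of [T]: a part
    missing [T] would have a partner containing [T], that is, a TOIDS. *)
Lemma toi_coalition_number_kernel T :
  (forall D, toids D = (T \subset D)) -> toi_coalition_number G <= #|T|.
Proof.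
move=> toidsE; apply/bigmax_leqP => Psi PsiP.
have /andP[/and3P[_ tr _] _] := PsiP.
apply: card_trivIset_meet => // X XP; apply/negP => dis.
have [Y YP /and5P[_ _ _ _ /andP[]]] := coalition_partner PsiP XP.
rewrite !toidsE => /negP nTY /subsetP TXY; apply: nTY.
apply/subsetP => t tT; have := TXY t tT.
by rewrite inE (disjointFl dis tT).
Qed.

Lemma toi_coalition_number_card : toi_coalition_number G <= #|G|.
Proof.
rewrite -cardsT; apply/bigmax_leqP => Psi /andP[/and3P[_ tr n0] _].
apply: card_trivIset_meet => // X XP; rewrite -setI_eq0 setIT.
by apply: contraNneq n0 => <-.
Qed.

(** The parts other than two partners live in the complement of a TOIDS. *)
Lemma toi_coalition_number_codim m :
  (forall D, toids D -> #|~: D| <= m) -> toi_coalition_number G <= m.+2.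
Proof.
move=> small; apply/bigmax_leqP => Psi PsiP.
have /andP[/and3P[_ tr n0] _] := PsiP.
have [->|[X XP]] := set_0Vmem Psi; first by rewrite cards0.
have [Y YP c] := coalition_partner PsiP XP.
have /and5P[_ _ _ _ /andP[_ toidsXY]] := c.
rewrite (cardsD1 X) XP (cardsD1 Y) !inE eq_sym (toi_coalition_neq c) YP /=.
rewrite !add1n !ltnS; apply: leq_trans (small _ toidsXY).
apply: card_trivIset_meet.
  by apply: trivIsetS tr; apply/subsetP => Z; rewrite !inE => /and3P[].
move=> Z; rewrite !inE => /and3P[ZY ZX ZP].
have /set0Pn[z zZ] : Z != set0 by apply: contraNneq n0 => <-.
have dis W : W \in Psi -> Z != W -> z \notin W.
  by move=> WP ZW; rewrite (disjointFr (trivIsetP tr Z W ZP WP ZW) zZ).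
by apply/pred0Pn; exists z; rewrite /= zZ !inE negb_or !dis.
Qed.

Lemma coalitions_meet Psi X Y Z W :
  trivIset Psi -> X \in Psi -> Y \in Psi -> Z \in Psi -> W \in Psi ->
  toi_coalition X Y -> toi_coalition Z W ->
  [|| Z == X, Z == Y, W == X | W == Y].
Proof.
move=> /trivIsetP tr XP YP ZP WP /and5P[X0 _ _ _ /andP[_ tXY]].
move=> /and5P[_ _ _ _ /andP[_ tZW]]; have /set0Pn[v0 _] := X0.
apply/negPn; apply: contra (toids_meet v0 tXY tZW); rewrite !negb_or.
case/and4P=> ZX ZY WX WY; rewrite -setI_eq0 setIUl !setIUr.
have dis A B : A \in Psi -> B \in Psi -> B != A -> A :&: B = set0.
  by move=> AP BP BA; apply/eqP; rewrite setI_eq0; apply: tr; rewrite // eq_sym.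
by rewrite !dis // !setU0.
Qed.

(** Two intersecting coalitions [XY] and [XZ] force every coalition of a fourth
    part to go through [X], since it must meet both of them. *)
Lemma coalition_star Psi :
  toi_coalition_partition Psi -> 3 < #|Psi| ->
  exists2 X, X \in Psi & {in Psi :\ X, forall Y, toi_coalition X Y}.
Proof.
move=> PsiP card4; have /andP[/and3P[_ tr _] _] := PsiP.
have more (A B C : {set G}) : exists2 W, W \in Psi & W \notin [set A; B; C].
  apply/subsetPn/negP => /subset_leq_card; rewrite leqNgt => /negP; apply.
  apply: leq_trans card4; rewrite ltnS -setUA setUC.
  by rewrite (leq_trans (leq_card_setU _ _)) // cards2 cards1; case: eqP.
have [X XP _] := more set0 set0 set0.
have [Y YP cXY] := coalition_partner PsiP XP.
have [Z ZP nZ] := more X Y Y.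
have [Z' Z'P cZ] := coalition_partner PsiP ZP.
(* It suffices to find two coalitions AB and AC: a coalition WW' avoiding A would
   have to be BC, while W is neither B nor C. *)
have fin A B C : A \in Psi -> B \in Psi -> C \in Psi -> C != A -> C != B ->
    toi_coalition A B -> toi_coalition A C ->
    exists2 X, X \in Psi & {in Psi :\ X, forall Y, toi_coalition X Y}.
  move=> AP BP CP CA CB cAB cAC; exists A => // W /setD1P[WA WP].
  have [->//|WB] := eqVneq W B; have [->//|WC] := eqVneq W C.
  have [W' W'P cW] := coalition_partner PsiP WP.
  have := coalitions_meet tr AP BP WP W'P cAB cW.
  have := coalitions_meet tr AP CP WP W'P cAC cW.
  rewrite (negPf WA) (negPf WB) (negPf WC) /=.
  have [eW' _ _|_ /= /eqP-> /eqP eCB] := eqVneq W' A.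
    by rewrite toi_coalitionC -eW'.
  by rewrite eCB eqxx in CB.
have := coalitions_meet tr XP YP ZP Z'P cXY cZ.
move: nZ; rewrite !inE !negb_or => /andP[/andP[ZX ZY] _].
rewrite (negPf ZX) (negPf ZY) /= => /orP[] /eqP eZ'.
  by apply: (fin X Y Z) => //; rewrite toi_coalitionC -eZ'.
by apply: (fin Y X Z) => //; rewrite toi_coalitionC // -eZ'.
Qed.

(** The set [T] is the defect of [X] that all partners of [X] must repair. *)
Lemma coalition_transversal d X :
  2 <= d -> (forall v, #|[set w | adj v w]| <= d) -> ~~ toids X ->
  exists2 T : {set G}, #|T| <= d & forall Y, toi_coalition X Y -> ~~ [disjoint Y & T].
Proof.
move=> d2 deg; rewrite negb_and => /orP[/forallPn[v /exists_inPn nX]|].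
  exists [set w | adj v w] => // Y /and5P[_ _ _ _ /andP[_ /andP[dom _]]].
  have [w wXY vw] := total_dominatingP _ dom v.
  apply/pred0Pn; exists w; rewrite /= inE vw andbT.
  by case/setUP: wXY => // /nX; rewrite vw.
case/forall_inPn => v vX /forall_inPn[w wX]; rewrite negbK => vw.
exists [set v; w]; first by rewrite cards2 (leq_trans _ d2) //; case: eqP.
move=> Y /and5P[_ _ _ _ /andP[_ /andP[_ /independentP ind]]].
apply/negP => dis; suff : ~~ adj v w by rewrite vw.
apply: ind.
  by move: vX; rewrite !inE negb_or (disjointFl dis) ?set21 // andbT.
by move: wX; rewrite !inE negb_or (disjointFl dis) ?set22 // andbT.
Qed.

Lemma toi_coalition_number_degree d :
  2 <= d -> (forall v, #|[set w | adj v w]| <= d) ->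
  toi_coalition_number G <= d.+1.
Proof.
move=> d2 deg; apply/bigmax_leqP => Psi PsiP.
have [le3|gt3] := leqP #|Psi| 3; first exact: leq_trans le3 _.
have /andP[/and3P[_ tr _] _] := PsiP.
have [X XP star] := coalition_star PsiP gt3.
have nX : ~~ toids X.
  by have [Y _ /and5P[]] := coalition_partner PsiP XP.
have [T leT meet] := coalition_transversal d2 deg nX.
rewrite (cardsD1 X) XP add1n ltnS; apply: leq_trans leT.
apply: card_trivIset_meet => [|Y YP]; last exact/meet/star.
by apply: trivIsetS tr; apply: subsetDl.
Qed.

(** * Lower bounds *)

Lemma toi_coalition_number_ge Psi :
  toi_coalition_partition Psi -> #|Psi| <= toi_coalition_number G.
Proof. exact: (@leq_bigmax_cond _ _ (fun Psi : {set {set G}} => #|Psi|)). Qed.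

(** The parts are [D] and the singletons outside it. A singleton is never a
    TOIDS, its element having no neighbour in it, so [D] is a partner of each of
    them. *)
Lemma star_lower_bound D :
  D != set0 -> D != setT -> ~~ toids D ->
  (forall b, b \notin D -> toids (D :|: [set b])) ->
  #|~: D| < toi_coalition_number G.
Proof.
move=> D0 DT nD tD.
pose Psi := D |: [set [set b] | b in ~: D].
have notin : D \notin [set [set b] | b in ~: D].
  by apply/imsetP => [[b]]; rewrite inE => /negP nb eD; apply: nb; rewrite eD set11.
have coal b : b \notin D -> toi_coalition D [set b].
  move=> bD; rewrite /toi_coalition D0 nD toids1F tD // -card_gt0 cards1.
  by rewrite disjoint_sym disjoints1 bD.
have cardPsi : #|Psi| = #|~: D|.+1.
  by rewrite cardsU1 notin card_imset //; apply: set1_inj.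
rewrite -cardPsi; apply: toi_coalition_number_ge; apply/andP; split.
  apply/and3P; split.
  - apply/eqP/setP => x; rewrite inE; apply/bigcupP.
    have [xD|xD] := boolP (x \in D); first by exists D; rewrite ?setU11.
    by exists [set x]; rewrite ?set11 // setU1r // imset_f // inE.
  - apply/trivIsetP => A B.
    case/setU1P=> [->|/imsetP[a aD ->]] /setU1P[->|/imsetP[b bD ->]].
    + by rewrite eqxx.
    + by move: bD; rewrite inE disjoint_sym disjoints1.
    + by move: aD; rewrite inE disjoints1.
    + by apply: contraNT; rewrite disjoints1 inE negbK => /eqP->.
  - rewrite !inE negb_or eq_sym D0 /=; apply/imsetP => [[b _ e0]].
    by have := set11 b; rewrite -e0 inE.
apply/forall_inP => X /setU1P[->|/imsetP[b]].
  have /set0Pn[b] : ~: D != set0 by apply: contraNneq DT => e; rewrite -[D]setCK e setC0.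
  rewrite inE => bD; apply/existsP; exists [set b].
  by rewrite eq_sym (toi_coalition_neq (coal b bD)) coal // setU1r // imset_f // inE.
rewrite inE => bD ->; apply/existsP; exists D.
by rewrite setU11 (toi_coalition_neq (coal b bD)) toi_coalitionC coal.
Qed.

(** The parts are [[set a]], [[set b]] and the rest. Deleting a single vertex
    leaves a TOIDS as soon as this vertex is nobody's only neighbour. *)
Lemma three_lower_bound a b :
  a != b -> ~~ toids (~: [set a; b]) ->
  (forall v, exists2 w, w != a & adj v w) ->
  (forall v, exists2 w, w != b & adj v w) ->
  2 < toi_coalition_number G.
Proof.
move=> ab nD Ha Hb; have cab : #|[set a; b]| = 2 by rewrite cards2 ab.
rewrite -cab -(setCK [set a; b]); apply: star_lower_bound => //.
- have [w wb aw] := Hb a; apply/set0Pn; exists w; rewrite !inE negb_or wb andbT.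
  by apply: contraTneq aw => ->; rewrite adj_irr.
- by apply/eqP => /setP/(_ a); rewrite !inE eqxx.
move=> x; rewrite inE negbK => /set2P[]->.
  suff -> : ~: [set a; b] :|: [set a] = ~: [set b] by apply: toids_setC1.
  by apply/setP => y; rewrite !inE; have [->|] := eqVneq y a; rewrite ?ab ?orbF.
suff -> : ~: [set a; b] :|: [set b] = ~: [set a] by apply: toids_setC1.
apply/setP => y; rewrite !inE; have [->|] := eqVneq y b; rewrite ?orbF ?orbT //.
by rewrite eq_sym ab.
Qed.

Lemma adjacent_not_toids a b : adj a b -> ~~ toids (~: [set a; b]).
Proof.
move=> ab; rewrite /toids setCK negb_and; apply/orP; right.
by apply/negP => /independentP/(_ a b); rewrite set21 set22 ab => /(_ isT isT).
Qed.

Lemma two_lower_bound X :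
  ~~ toids X -> ~~ toids (~: X) -> toids [set: G] ->
  1 < toi_coalition_number G.
Proof.
move=> nX nXC tT.
have X0 : X != set0 by apply: contraNneq nXC => ->; rewrite setC0.
have XC0 : ~: X != set0.
  by apply: contraNneq nX => e; rewrite -[X]setCK e setC0.
have dis : [disjoint X & ~: X] by rewrite -setI_eq0 setICr.
have c : toi_coalition X (~: X).
  by rewrite /toi_coalition X0 XC0 dis nX nXC setUCr.
have ne := toi_coalition_neq c.
have <- : #|[set X; ~: X]| = 2 by rewrite cards2 ne.
apply: toi_coalition_number_ge; apply/andP; split.
  apply/and3P; split.
  - by rewrite /cover bigcup_setU !big_set1 setUCr.
  - apply/trivIsetP => A B /set2P[]-> /set2P[]->; rewrite ?eqxx //.
    by rewrite disjoint_sym.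
  - by rewrite !inE negb_or ![set0 == _]eq_sym X0.
apply/forall_inP => A /set2P[]->; apply/existsP.
  by exists (~: X); rewrite set22 eq_sym ne.
by exists X; rewrite set21 ne toi_coalitionC.
Qed.

End General.

(** * The four families *)

Lemma complete_graph_number n :
  3 <= n -> toi_coalition_number (complete_graph n) = 3.
Proof.
case: n => [|[|[|n]]] // _; apply/eqP; rewrite eqn_leq; apply/andP; split.
  apply: toi_coalition_number_codim => D /andP[_ /independentP ind].
  apply/card_le1P => x xD y.
  rewrite [RHS]inE; apply/idP/eqP => [yD|->//]; apply/eqP.
  by have := ind y x yD xD; rewrite /adj /= /complete_adj negbK.
pose i0 : complete_graph n.+3 := @ord0 n.+2.
pose i1 : complete_graph n.+3 := @Ordinal n.+3 1 isT.
pose i2 : complete_graph n.+3 := @Ordinal n.+3 2 isT.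
apply: (@three_lower_bound _ i0 i1) => //; first exact: adjacent_not_toids.
  by move=> v; have [->|ne] := eqVneq v i1; [exists i2|exists i1].
by move=> v; have [->|ne] := eqVneq v i0; [exists i2|exists i0].
Qed.

Lemma biclique_number r s :
  0 < r -> 0 < s -> r <= s ->
  toi_coalition_number (complete_bipartite_graph r s) = s + 1.
Proof.
move=> r0 s0 rs; pose G := complete_bipartite_graph r s.
rewrite addn1; apply/eqP; rewrite eqn_leq; apply/andP; split.
  have [s2|s1] := leqP 2 s.
    apply: toi_coalition_number_degree => // [[i|j]].
      rewrite -[s in _ <= s]card_ord -(card_imset 'I_s (@inr_inj 'I_r 'I_s)).
      apply/subset_leq_card/subsetP => [[k|k]]; rewrite inE // => _.
      exact: imset_f.
    apply: leq_trans rs.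
    rewrite -[r in _ <= r]card_ord -(card_imset 'I_r (@inl_inj 'I_r 'I_s)).
    apply/subset_leq_card/subsetP => [[k|k]]; rewrite inE // => _.
    exact: imset_f.
  apply: leq_trans (toi_coalition_number_card _) _.
  by rewrite card_sum !card_ord -addn1 addnC leq_add2l (leq_trans rs).
pose D : {set G} := [set x | if x is inl _ then true else false].
have cD : #|~: D| = s.
  rewrite -[s in RHS]card_ord -(card_imset 'I_s (@inr_inj 'I_r 'I_s)).
  apply/eq_card => [[k|k]]; rewrite !inE /=.
    by apply/esym/imsetP => [[]].
  by apply/esym/imset_f.
rewrite -[X in X < _]cD; apply: star_lower_bound.
- by apply/set0Pn; exists (inl (Ordinal r0)); rewrite inE.
- by apply/eqP => /setP/(_ (inr (Ordinal s0))); rewrite !inE.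
- rewrite negb_and; apply/orP; left; apply/negP.
  by move=> /total_dominatingP/(_ (inl (Ordinal r0)))[[k|k]]; rewrite inE.
case=> [i|j]; rewrite inE // => _; apply/andP; split.
  apply/total_dominatingP => [[i|i]]; first by exists (inr j); rewrite ?inE ?eqxx.
  by exists (inl (Ordinal r0)); rewrite ?inE.
by apply/independentP => [[k|k] [l|l]]; rewrite !inE.
Qed.

Lemma path_degree n (v : path_graph n) : #|[set w | adj v w]| <= 2.
Proof.
case: n v => [[]//|n] v.
apply: (@leq_trans #|[set inord v.+1; inord v.-1 : path_graph n.+1]|).
  apply/subset_leq_card/subsetP => w; rewrite !inE => /orP[] /eqP e.
    by rewrite e inord_val eqxx.
  by rewrite -e inord_val eqxx orbT.
by rewrite cards2; case: eqP.
Qed.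

(** The two removed vertices 0 and 2 are the neighbours of 1. Neither of them is
    the only neighbour of a vertex, as long as 2 is not the penultimate
    vertex. *)
Lemma path_number n :
  3 <= n -> n != 4 -> toi_coalition_number (path_graph n) = 3.
Proof.
case: n => [|[|[|n]]] // _ n4; apply/eqP; rewrite eqn_leq; apply/andP; split.
  exact: toi_coalition_number_degree (@path_degree _).
pose i0 : path_graph n.+3 := @ord0 n.+2.
pose i1 : path_graph n.+3 := @Ordinal n.+3 1 isT.
pose i2 : path_graph n.+3 := @Ordinal n.+3 2 isT.
apply: (@three_lower_bound _ i0 i2) => //.
- rewrite negb_and; apply/orP; left; apply/negP.
  move=> /total_dominatingP/(_ i1)[w]; rewrite !inE negb_or => /andP[w0 w2].
  case/orP=> /eqP /= e; first by case/eqP: w2; apply: val_inj.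
  by case/eqP: w0; apply: val_inj; case: e.
- move=> v; have [lt2|ge2] := ltnP v.+1 n.+3.
    by exists (Ordinal lt2); rewrite //= /path_adj /= eqxx.
  have lt : v.-1 < n.+3 by rewrite (leq_ltn_trans (leq_pred _)).
  have v1 : 1 < v by rewrite -ltnS (leq_trans _ ge2).
  exists (Ordinal lt); first by rewrite -val_eqE /=; case: (v : nat) v1 => [|[]].
  by rewrite /= /path_adj /= prednK ?eqxx ?orbT // ltnW.
move=> v; have [lev|gtv] := leqP v 1.
  have [->|nv] := eqVneq v i0; first by exists i1.
  exists i0 => //; apply/orP; right.
  by rewrite eqn_leq lev andbT lt0n.
(* For v > 1, the predecessor of v avoids 2 unless v is 3; the
   path then has more than four vertices, and 3 has the successor 4. *)
have [e3|ne3] := eqVneq (val v) 3.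
  have lt : 4 < n.+3 by rewrite ltn_neqAle eq_sym n4 -[3]e3 ltn_ord.
  by exists (Ordinal lt); rewrite //= /path_adj /= e3.
have lt : v.-1 < n.+3 by rewrite (leq_ltn_trans (leq_pred _)).
exists (Ordinal lt); last by rewrite /= /path_adj /= prednK ?eqxx ?orbT // ltnW.
rewrite -val_eqE /=; apply: contraNneq ne3 => e.
by rewrite -[val v]prednK ?e // ltnW.
Qed.

Lemma path4_number : toi_coalition_number (path_graph 4) = 2.
Proof.
pose i0 : path_graph 4 := @Ordinal 4 0 isT.
pose i1 : path_graph 4 := @Ordinal 4 1 isT.
pose i2 : path_graph 4 := @Ordinal 4 2 isT.
pose i3 : path_graph 4 := @Ordinal 4 3 isT.
have cases (P : pred (path_graph 4)) : P i0 -> P i1 -> P i2 -> P i3 -> forall v, P v.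
  move=> p0 p1 p2 p3 [[|[|[|[|//]]]] lt].
  - by rewrite (_ : Ordinal lt = i0) //; apply: val_inj.
  - by rewrite (_ : Ordinal lt = i1) //; apply: val_inj.
  - by rewrite (_ : Ordinal lt = i2) //; apply: val_inj.
  - by rewrite (_ : Ordinal lt = i3) //; apply: val_inj.
(* Vertices 1 and 2 are the only neighbours of the ends 0 and 3, together
   dominate every vertex, and leave outside only the non-adjacent 0 and 3. *)
have toidsE (D : {set path_graph 4}) : toids D = ([set i1; i2] \subset D).
  apply/idP/idP => [/andP[/total_dominatingP dom _]|].
    rewrite subUset !sub1set; apply/andP; split.
      have [w wD a0] := dom i0; suff <- : w = i1 by [].
      by apply/eqP; move: a0; apply/implyP; move: w {wD}; apply: cases.
    have [w wD a3] := dom i3; suff <- : w = i2 by [].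
    by apply/eqP; move: a3; apply/implyP; move: w {wD}; apply: cases.
  rewrite subUset !sub1set => /andP[D1 D2]; apply/andP; split.
    by apply/forallP; apply: cases; apply/existsP;
      solve [exists i1; by rewrite D1 | exists i2; by rewrite D2].
  apply/forallP; apply: (cases); apply/implyP; rewrite inE ?D1 ?D2 // => _;
    by apply/forallP; apply: (cases); apply/implyP; rewrite inE ?D1 ?D2.
apply/eqP; rewrite eqn_leq; apply/andP; split.
  by apply: leq_trans (toi_coalition_number_kernel toidsE) _; rewrite cards2.
apply: (@two_lower_bound _ [set i0; i1]); rewrite toidsE ?subsetT //.
  by rewrite subUset !sub1set !inE.
by rewrite subUset !sub1set !inE.
Qed.

Lemma cycle_number n : 3 <= n -> toi_coalition_number (cycle_graph n) = 3.
Proof.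
move=> n3; apply/eqP; rewrite eqn_leq; apply/andP; split.
  apply: toi_coalition_number_degree => // v.
  apply: (@leq_trans #|[set ordS v; ord_pred v : cycle_graph n]|).
    apply/subset_leq_card/subsetP => w; rewrite !inE.
    case/andP=> _ /orP[] /eqP <-; first by rewrite eqxx.
    by rewrite ordSK eqxx orbT.
  by rewrite cards2; case: eqP.
(* For n >= 3 a shift by 2 has no fixed point, so the successor and the
   predecessor of a vertex differ: one of them avoids any given vertex. *)
have SS (v : 'I_n) : ordS (ordS v) != v.
  rewrite -val_eqE /=; have := ltn_ord v; rewrite leq_eqVlt => /orP[/eqP e|lt].
    by rewrite e modnn modn_small ?(ltnW n3) // -eqSS e ltn_eqF.
  rewrite [v.+1 %% n]modn_small //.
  move: lt; rewrite leq_eqVlt => /orP[/eqP e|lt].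
    by rewrite e modnn; case: (val v) e => // e; rewrite -e in n3.
  by rewrite modn_small // gtn_eqF.
have S1 (v : 'I_n) : v != ordS v.
  by apply: contra (SS v) => /eqP e; rewrite -!e.
have nbr (a v : cycle_graph n) : exists2 w : cycle_graph n, w != a & adj v w.
  have [<-|ne] := eqVneq (ordS v) a; last first.
    by exists (ordS v); rewrite //= /cycle_adj S1 eqxx.
  exists (ord_pred v).
    by apply: contra (SS v) => /eqP <-; rewrite ord_predK.
  by rewrite /= /cycle_adj ord_predK eqxx orbT -{1}(ord_predK v) eq_sym S1.
pose i0 : cycle_graph n := Ordinal (ltnW (ltnW n3)).
apply: (@three_lower_bound _ i0 (ordS i0)) => //.
by apply: adjacent_not_toids; rewrite /= /cycle_adj S1 eqxx.
Qed.

Theorem theorem2 :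
  (forall n : nat, 3 <= n -> toi_coalition_number (complete_graph n) = 3) /\
  (forall r s : nat, 0 < r -> 0 < s -> r <= s ->
     toi_coalition_number (complete_bipartite_graph r s) = s + 1) /\
  (forall n : nat, 3 <= n ->
     (n = 3 -> toi_coalition_number (path_graph n) = 3) /\
     (n = 4 -> toi_coalition_number (path_graph n) = 2) /\
     (5 <= n -> toi_coalition_number (path_graph n) = 3)) /\
  (forall n : nat, 3 <= n -> toi_coalition_number (cycle_graph n) = 3).
Proof.
split; first exact: complete_graph_number.
split; first exact: biclique_number.
split; last exact: cycle_number.
move=> n n3; split=> [->|]; first exact: path_number.
split=> [->|n5]; first exact: path4_number.
by apply: path_number => //; rewrite gtn_eqF.
Qed.
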